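(* Let $n=3$, let $S\subset\mathbb{R}^3$ be a smooth cylinder surface with axis vector $e$, and let $q(t)=(A(t),a(t))$ satisfy the constrained Newton's equation for the rolling motion on $S$ of the particle of radius $r$, mass $m$, mass distribution parameter $\gamma$, subject to the constant force $-mge$; write $\dot q=(UA,u)$ and define the angular velocity vector $\omega$ by $Ux=\omega\times x$ for all $x\in\mathbb{R}^3$. Then $\omega\cdot e$ is constant in $t$ and $$\frac{d}{dt}(u\cdot e)+\frac{\gamma^2}{1+\gamma^2}r^2\lambda(a)(\omega\cdot e)(\omega\cdot\nu_a)+\frac{g}{1+\gamma^2}=0,\qquad \frac{d}{dt}(\omega\cdot\nu_a)=\lambda(a)(\omega\cdot e)(u\cdot e).$$ Consequently the height $h=a\cdot e$ of the center of mass (for which $\dot h=u\cdot e$) satisfies, with $\omega_e=\omega\cdot e$ and $\omega_\nu=\omega\cdot\nu_a$, $$\ddot h+\frac{\gamma^2}{1+\gamma^2}r^2\lambda(a)\omega_e(0)\Big[\omega_\nu(0)+\omega_e(0)\int_0^t\lambda(a(s))\dot h(s)\,ds\Big]+\frac{g}{1+\gamma^2}=0.$$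
   Context: The particle is a ball of radius $r>0$ with rotationally symmetric mass distribution of total mass $m$ and second-moment matrix per unit mass $\lambda I$, $\lambda=(r\gamma)^2/2$, $\gamma>0$. $S$ is the surface of positions of the particle's center, $\nu_a$ its inward unit normal at $a$, $\tau_a=\nu_a\times e$, and $\lambda(a)$ the principal curvature of $S$ at $a$ in direction $\tau_a$ (i.e. $\mathbb{S}_a\tau_a=\lambda(a)\tau_a$, where the shape operator is $\mathbb{S}_av=-D_v\nu$). On $M=SO(3)\times S$ use the kinetic energy metric $\langle(U_\xi A,u_\xi),(U_\eta A,u_\eta)\rangle=m\{\tfrac{(r\gamma)^2}{2}\mathrm{Tr}(U_\xi U_\eta^\dagger)+u_\xi\cdot u_\eta\}$ with Levi-Civita connection $\nabla$; for $\dot q=(UA,u)$ one has $\frac{\nabla\dot q}{dt}=(\dot UA,\frac{Du}{dt})$, $D$ the Levi-Civita connection of $S$. The no-slip space at $q=(A,a)$ is $\mathfrak{S}_q=\{(UA,u):u=rU\nu_a\}$ and $\mathfrak{S}^\perp_q$ is its orthogonal complement inside $T_qM$. A path satisfies the constrained Newton's equation with force $f=(0,-mge)$ if $\dot q(t)\in\mathfrak{S}_{q(t)}$ for all $t$ and $\frac{\nabla\dot q}{dt}=m^{-1}f+N$ with $N(t)\in\mathfrak{S}^\perp_{q(t)}$. *)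

(* Defs.v *)
From HB Require Import structures.
From mathcomp Require Import all_boot all_order all_algebra.
From mathcomp Require Import all_classical all_reals all_analysis.
Import Order.TTheory GRing.Theory Num.Theory.
Import numFieldNormedType.Exports.
Local Open Scope classical_set_scope.
Local Open Scope ring_scope.

Set Implicit Arguments.
Unset Strict Implicit.
Unset Printing Implicit Defensive.

Section Defs.
Variable R : realType.
Local Notation vec := 'cV[R]_3.
Local Notation mat := 'M[R]_3.

Definition i0 : 'I_3 := @Ordinal 3 0 isT.
Definition i1 : 'I_3 := @Ordinal 3 1 isT.
Definition i2 : 'I_3 := @Ordinal 3 2 isT.

Definition dot (u v : vec) : R := \sum_i u i 0 * v i 0.
Definition cross (u v : vec) : vec :=
  \col_(i < 3) nth 0 [:: u i1 0 * v i2 0 - u i2 0 * v i1 0;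
                         u i2 0 * v i0 0 - u i0 0 * v i2 0;
                         u i0 0 * v i1 0 - u i1 0 * v i0 0] i.

Definition skew (U : mat) : Prop := U^T = - U.
Definition SO3 (A : mat) : Prop := A^T *m A = 1%:M /\ \det A = 1.

Definition ebasis (i : 'I_3) : vec := delta_mx i 0.
Definition partial (i : 'I_3) (f : vec -> R) (x : vec) : R := 'd f x (ebasis i).
Definition grad (f : vec -> R) (x : vec) : vec := \col_i partial i f x.

Definition C1_on (W : normedModType R) (O : set vec) (f : vec -> W) : Prop :=
  (forall x, O x -> differentiable f x) /\
  (forall v x, O x -> (fun y => 'd f y v) y @[y --> x] --> 'd f x v).

Definition surf (O : set vec) (phi : vec -> R) : set vec :=
  [set x | O x /\ phi x = 0].

Definition cylinder_surface (O : set vec) (phi : vec -> R) (e : vec) : Prop :=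
  [/\ open O, C1_on O phi, (forall i, C1_on O (partial i phi)),
      (forall x, surf O phi x -> grad phi x != 0) &
      (forall x (s : R), surf O phi x -> surf O phi (x + s *: e))].

Definition nu (phi : vec -> R) (x : vec) : vec :=
  (Num.sqrt (dot (grad phi x) (grad phi x)))^-1 *: grad phi x.
Definition shape_op (phi : vec -> R) (a v : vec) : vec := - 'd (nu phi) a v.
Definition tau (phi : vec -> R) (e a : vec) : vec := cross (nu phi a) e.

(** Levi-Civita connection of S along a curve: tangential projection of the
    ambient derivative *)
Definition tproj (phi : vec -> R) (a w : vec) : vec :=
  w - dot w (nu phi a) *: nu phi a.

(** Tangent vectors of M = SO(3) x S at q = (A,a) are written (U A, u) and
    represented by the pair (U, u). *)
Definition TM (phi : vec -> R) (a : vec) (X : mat * vec) : Prop :=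
  skew X.1 /\ dot X.2 (nu phi a) = 0.

Definition metric (r m gam : R) (X Y : mat * vec) : R :=
  m * ((r * gam) ^+ 2 / 2 * \tr (X.1 *m Y.1^T) + dot X.2 Y.2).

Definition noslip (r : R) (phi : vec -> R) (a : vec) (X : mat * vec) : Prop :=
  skew X.1 /\ X.2 = r *: (X.1 *m nu phi a).

Definition noslip_perp (r m gam : R) (phi : vec -> R) (a : vec)
    (N : mat * vec) : Prop :=
  TM phi a N /\
  forall X, noslip r phi a X -> metric r m gam N X = 0.

(** q'(t) = (U(t) A(t), u(t)) *)
Definition angU (A : R -> mat) (t : R) : mat := derive1 A t *m (A t)^T.
Definition vel (a : R -> vec) (t : R) : vec := derive1 a t.

(** constrained Newton's equation with force f = (0, -m g e) on the time set I *)
Definition constrained_newton (r m gam g : R) (e : vec) (O : set vec)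
    (phi : vec -> R) (I : set R) (A : R -> mat) (a : R -> vec) : Prop :=
  forall t, I t ->
  [/\ SO3 (A t) /\ surf O phi (a t),
      derivable A t 1 /\ derivable a t 1,
      derivable (angU A) t 1 /\ derivable (vel a) t 1,
      noslip r phi (a t) (angU A t, vel a t) &
      noslip_perp r m gam phi (a t)
        (derive1 (angU A) t - 0,
         tproj phi (a t) (derive1 (vel a) t) - m^-1 *: (- (m * g) *: e))].

Definition oint (f : R -> R) (x y : R) : R :=
  if x <= y then Rintegral lebesgue_measure `[x, y] f
  else - Rintegral lebesgue_measure `[y, x] f.

End Defs.

(* Main.v *)
(** The normal [nu] is constant along the rulings, so along the motion
    [nu' = - lam (u . tau) tau], and rolling without slipping reads
    [u = r omega x nu].  Testing the reaction force against all no-slip motions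
    gives [r gam^2 omega' + nu x (u' + g e) = 0].  Differentiating
    [u = r omega x nu] and taking components in the frame [(nu, e, tau)] gives
    the conservation law and the two evolution equations; integrating the one
    for [omega . nu] yields the height equation.  That [nu] does not turn along
    the rulings is where the symmetry of second derivatives of [phi] enters. *)
Require Import Defs.
From HB Require Import structures.
From mathcomp Require Import all_boot all_order all_algebra.
From mathcomp Require Import all_classical all_reals all_analysis.
From mathcomp Require Import ring lra.
Import Order.TTheory GRing.Theory Num.Theory.
Import numFieldNormedType.Exports.
Local Open Scope classical_set_scope.
Local Open Scope ring_scope.

(** * Symmetry of second derivatives *)

Lemma is_derive_curve (R : realType) (V W : normedModType R) (f : V -> W)
    (c : R -> V) (t : R) (dc : V) :
  is_derive t 1 c dc -> differentiable f (c t) ->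
  is_derive t 1 (fun s => f (c s)) ('d f (c t) dc).
Proof.
move=> [/derivable1_diffP hc <-] df.
have hfc := @is_diff_comp _ _ _ _ _ _ _ _ _ (differentiableP hc) (differentiableP df).
apply: DeriveDef; first exact/diff_derivable.
by rewrite !deriveE// diff_val.
Qed.

Lemma is_derive_line (R : realType) (V W : normedModType R) (f : V -> W)
    (x u : V) (s : R) :
  differentiable f (x + s *: u) ->
  is_derive s 1 (fun s => f (x + s *: u)) ('d f (x + s *: u) u).
Proof.
apply: (@is_derive_curve _ _ _ _ (fun s => x + s *: u)).
have dl : is_diff s (fun s => x + s *: u) (fun s => s *: u).
  by apply: is_diff_eq; rewrite add0r.
apply: DeriveDef; first exact/diff_derivable.
by rewrite deriveE// diff_val scale1r.
Qed.

(** The mean value theorem in direction [u] turns the second difference into [h] times the increment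
    of [g] from [x + c *: u] to [x + c *: u + h *: v]. The first-order expansion of [g] at [x]
    evaluates this increment up to [o(h)], uniformly in the unknown [c] between 0 and [h]. *)
Lemma second_difference (R : realType) (V : normedModType R) (f : V -> R)
    (x u v : V) (eps : R) :
  (\forall y \near x, differentiable f y) ->
  differentiable (fun y => 'd f y u) x -> 0 < eps ->
  \forall h \near 0^'+,
    `|f (x + (h *: u + h *: v)) - f (x + h *: u) - f (x + h *: v) + f x
      - h ^+ 2 * 'd (fun y => 'd f y u) x v| <= eps * h ^+ 2.
Proof.
set g := fun y => 'd f y u => df dg eps0.
(* All displacements used have norm at most [h * C]; the summand 1 keeps [C] positive when [u] and
   [v] vanish. The expansion of [g] is used at two points, so each gets the tolerance
   [eps / (2 * C)]. *)
pose C := `|u| + `|v| + 1.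
have C0 : 0 < C by rewrite ltr_wpDl// addr_ge0.
have k0 : 0 < eps / (2 * C) by rewrite divr_gt0// mulr_gt0.
have /eqaddoP/(_ _ k0) : (fun w => g (x + w)) =
    (fun w => g x + 'd g x w) +o_ (0 : V) id.
  by apply/eqaddoE/funext => w; rewrite diff_locallyxC.
move=> /nbhs_norm0P[/= d1 d10 gd1].
have /nbhs_normP[/= d2 d20 fd2] := df.
near=> h.
have h0 : 0 < h by [].
have hC1 : h * C < d1.
  rewrite -ltr_pdivlMr//; near: h; apply: nbhs_right_lt; exact: divr_gt0.
have hC2 : h * C < d2.
  rewrite -ltr_pdivlMr//; near: h; apply: nbhs_right_lt; exact: divr_gt0.
have bound (s b : R) : 0 <= s <= h -> 0 <= b <= h ->
    `|s *: u + b *: v| <= h * C.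
  move=> /andP[s0 sh] /andP[b0 bh]; apply: le_trans (ler_normD _ _) _.
  rewrite !normrZ !ger0_norm// /C !mulrDr mulr1.
  have := ler_wpM2r (normr_ge0 u) sh; have := ler_wpM2r (normr_ge0 v) bh.
  by move=> *; lra.
have dfx s b : 0 <= s <= h -> 0 <= b <= h -> differentiable f (x + (s *: u + b *: v)).
  move=> sh bh; apply: fd2; rewrite /= opprD addNKr normrN.
  exact: le_lt_trans (bound _ _ sh bh) hC2.
(* The second difference is [G h - G 0]. *)
pose G s := f (x + h *: v + s *: u) - f (x + s *: u).
pose G' s := g (x + h *: v + s *: u) - g (x + s *: u).
have dG s : s \in `[0, h] -> is_derive s 1 G (G' s).
  rewrite in_itv/= => sh; apply: is_deriveB.
    apply: is_derive_line; rewrite -addrA [h *: v + _]addrC.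
    by apply: dfx => //; rewrite lexx ltW.
  apply: is_derive_line; have := dfx s 0; rewrite scale0r addr0; apply=> //.
  by rewrite lexx ltW.
have cG : {within `[0, h], continuous G}.
  apply: derivable_within_continuous => s hs.
  exact: (@ex_derive _ _ _ _ _ _ _ (dG s hs)).
have dG' s : s \in `]0, h[ -> is_derive s 1 G (G' s).
  by move=> /subset_itv_oo_cc; exact: dG.
have [c] := MVT h0 dG' cG.
move=> /subset_itv_oo_cc; rewrite in_itv/= => ch.
have near_g s b : 0 <= s <= h -> 0 <= b <= h ->
    `|g (x + (s *: u + b *: v)) - (g x + 'd g x (s *: u + b *: v))| <=
    eps / (2 * C) * (h * C).
  move=> sh bh; apply: le_trans (gd1 _ _) _.
    exact: le_lt_trans (bound _ _ sh bh) hC1.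
  by rewrite ler_wpM2l ?(ltW k0)//; exact: bound.
have hh : 0 <= h <= h by rewrite lexx ltW.
have h00 : 0 <= (0 : R) <= h by rewrite lexx ltW.
have := near_g c h ch hh; have := near_g c 0 ch h00.
have -> : 'd g x (c *: u + h *: v) = 'd g x (c *: u) + h * 'd g x v.
  by rewrite linearD; congr (_ + _); exact: linearZ.
rewrite scale0r addr0.
have -> : eps / (2 * C) * (h * C) = eps / 2 * h.
  by field; rewrite (gt_eqF C0).
rewrite /G' /G subr0 scale0r !addr0.
rewrite (addrAC x (h *: v)) -[x + h *: u + h *: v]addrA.
rewrite (addrAC x (h *: v)) -[x + c *: u + h *: v]addrA.
set p := 'd g x v; set q := 'd g x (c *: u).
set g1 := g (x + c *: u); set g2 := g (x + (c *: u + h *: v)).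
move=> b1 b2 E.
have -> : f (x + (h *: u + h *: v)) - f (x + h *: u) - f (x + h *: v) + f x
   - h ^+ 2 * p = (g2 - g1 - h * p) * h.
  by rewrite mulrBl -E; ring.
rewrite normrM (ger0_norm (ltW h0)) expr2 mulrA ler_wpM2r ?(ltW h0)//.
(* The error is the difference of the two expansion errors, since the term [q] from the unknown [c]
   cancels. *)
have -> : g2 - g1 - h * p = (g2 - (g x + (q + h * p))) - (g1 - (g x + q)) by ring.
apply: le_trans (ler_normB _ _) _.
by apply: le_trans (lerD b2 b1) _; rewrite -mulrDl -splitr.
Unshelve. all: by end_near. Qed.

(** The second difference is unchanged when [u] and [v] are swapped, so both mixed derivatives
    approximate the same number, divided by [h ^+ 2], to within [eps / 2]. *)
Lemma second_derivative_sym (R : realType) (V : normedModType R) (f : V -> R)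
    (x u v : V) :
  (\forall y \near x, differentiable f y) ->
  differentiable (fun y => 'd f y u) x ->
  differentiable (fun y => 'd f y v) x ->
  'd (fun y => 'd f y u) x v = 'd (fun y => 'd f y v) x u.
Proof.
move=> df du dv; apply/eqP; rewrite -subr_eq0 -normr_le0.
apply/ler_addgt0Pl => eps eps0; rewrite addr0.
have e20 : 0 < eps / 2 by rewrite divr_gt0.
near (0 : R)^'+ => h.
have h2 : 0 < h ^+ 2 by rewrite exprn_gt0.
have B1 : `|f (x + (h *: u + h *: v)) - f (x + h *: u) - f (x + h *: v) + f x
      - h ^+ 2 * 'd (fun y => 'd f y u) x v| <= eps / 2 * h ^+ 2.
  by near: h; exact: second_difference.
have B2 : `|f (x + (h *: v + h *: u)) - f (x + h *: v) - f (x + h *: u) + f x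
      - h ^+ 2 * 'd (fun y => 'd f y v) x u| <= eps / 2 * h ^+ 2.
  by near: h; exact: second_difference.
rewrite [h *: v + _]addrC in B2.
rewrite -(ler_pM2r h2) -{1}(ger0_norm (ltW h2)) -normrM [in leRHS](splitr eps).
rewrite [in leRHS]mulrDl; apply: le_trans (lerD B2 B1); apply: le_trans (ler_normB _ _).
by rewrite le_eqVlt; apply/orP; left; apply/eqP; congr (`| _ |); ring.
Unshelve. all: by end_near. Qed.

(** * Vectors and matrices *)

Lemma forall_I3 (P : 'I_3 -> Prop) : P i0 -> P i1 -> P i2 -> forall i, P i.
Proof.
move=> h0 h1 h2 [[|[|[|//]]] hi].
- by rewrite (_ : Ordinal hi = i0)//; exact: val_inj.
- by rewrite (_ : Ordinal hi = i1)//; exact: val_inj.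
- by rewrite (_ : Ordinal hi = i2)//; exact: val_inj.
Qed.

Lemma vecP (R : realType) (u v : 'cV[R]_3) :
  u i0 0 = v i0 0 -> u i1 0 = v i1 0 -> u i2 0 = v i2 0 -> u = v.
Proof. by move=> h0 h1 h2; apply/colP; exact: forall_I3. Qed.

Lemma sum3E (V : nmodType) (F : 'I_3 -> V) : \sum_i F i = F i0 + F i1 + F i2.
Proof.
rewrite !big_ord_recl big_ord0 addr0 addrA.
by congr (F _ + F _ + F _); exact: val_inj.
Qed.

Lemma dotE (R : realType) (u v : 'cV[R]_3) :
  dot u v = u i0 0 * v i0 0 + u i1 0 * v i1 0 + u i2 0 * v i2 0.
Proof. exact: sum3E. Qed.

Section vector_algebra.
Context {R : realType}.
Implicit Types u v w n e : 'cV[R]_3.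

Lemma crossE u v :
  (cross u v i0 0 = u i1 0 * v i2 0 - u i2 0 * v i1 0) *
  (cross u v i1 0 = u i2 0 * v i0 0 - u i0 0 * v i2 0) *
  (cross u v i2 0 = u i0 0 * v i1 0 - u i1 0 * v i0 0).
Proof. by rewrite !mxE. Qed.

Lemma dotC u v : dot u v = dot v u.
Proof. by rewrite !dotE; ring. Qed.

Lemma dotDl u v w : dot (u + v) w = dot u w + dot v w.
Proof. by rewrite !dotE !mxE; ring. Qed.

Lemma dotZl k u v : dot (k *: u) v = k * dot u v.
Proof. by rewrite !dotE !mxE; ring. Qed.

Lemma dotNl u v : dot (- u) v = - dot u v.
Proof. by rewrite !dotE !mxE; ring. Qed.

Lemma dotBl u v w : dot (u - v) w = dot u w - dot v w.
Proof. by rewrite dotDl dotNl. Qed.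

Lemma dot0l u : dot 0 u = 0.
Proof. by rewrite !dotE !mxE; ring. Qed.

Lemma crossN u v : cross u v = - cross v u.
Proof. by apply: vecP; rewrite !(crossE, mxE); ring. Qed.

Lemma crossDl u v w : cross (u + v) w = cross u w + cross v w.
Proof. by apply: vecP; rewrite !(crossE, mxE); ring. Qed.

Lemma crossZl k u v : cross (k *: u) v = k *: cross u v.
Proof. by apply: vecP; rewrite !(crossE, mxE); ring. Qed.

Lemma crossvv u : cross u u = 0.
Proof. by apply: vecP; rewrite !(crossE, mxE); ring. Qed.

Lemma dot_crossl u v w : dot (cross u v) w = dot u (cross v w).
Proof. by rewrite !dotE !crossE; ring. Qed.

Lemma cross_cross u v w : cross u (cross v w) = dot u w *: v - dot u v *: w.
Proof. by apply: vecP; rewrite !(dotE, crossE, mxE); ring. Qed.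

Lemma dot_gt0 u : u != 0 -> 0 < dot u u.
Proof.
move=> u0; rewrite lt_def; apply/andP; split; last first.
  by apply: sumr_ge0 => i _; rewrite -expr2 sqr_ge0.
apply: contra u0; rewrite psumr_eq0; last by move=> i _; rewrite -expr2 sqr_ge0.
move=> /allP h; apply/eqP/colP => i; apply/eqP.
by have := h i; rewrite mem_index_enum mxE -expr2 sqrf_eq0 => /(_ isT).
Qed.

Section frame.
Variables n e : 'cV[R]_3.
Hypotheses (nn : dot n n = 1) (ee : dot e e = 1) (ne : dot n e = 0).

Lemma frame_cross_ne_n : cross (cross n e) n = e.
Proof. by rewrite crossN cross_cross ne nn scale0r scale1r sub0r opprK. Qed.

Lemma frame_cross_ne_e : cross (cross n e) e = - n.
Proof.
by rewrite crossN cross_cross ee dotC ne scale0r scale1r subr0.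
Qed.

Lemma frame_dot_ne_e : dot (cross n e) e = 0.
Proof. by rewrite dot_crossl crossvv dotC dot0l. Qed.

Lemma frame_dot_ne_ne : dot (cross n e) (cross n e) = 1.
Proof. by rewrite -dot_crossl frame_cross_ne_n. Qed.

(** With [t = n x e], applying [t x] twice to [u] gives minus the part of [u] along [n] and [e],
    while the triple product formula gives [dot u t *: t - u]. Comparing the two yields the
    expansion. *)
Lemma frame_decomp u :
  u = dot u n *: n + dot u e *: e + dot u (cross n e) *: cross n e.
Proof.
set t := cross n e.
have tu : cross t u = dot u n *: e + (- dot u e) *: n.
  by rewrite crossN cross_cross opprB scaleNr.
have : cross t (cross t u) = - (dot u e *: e) - dot u n *: n.
  rewrite tu crossN crossDl !crossZl [cross e t]crossN [cross n t]crossN.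
  rewrite frame_cross_ne_n frame_cross_ne_e opprK scaleNr scalerN opprK.
  by rewrite opprD addrC.
rewrite cross_cross frame_dot_ne_ne scale1r (dotC t u) => E.
rewrite -{1}[u](subKr (dot u t *: t)) E opprB opprK.
by rewrite [LHS]addrC addrC.
Qed.

End frame.

End vector_algebra.

(** * Entrywise differentiation of matrix-valued maps *)

Section matrix_calculus.
Context {R : realType} {V : normedModType R} {m n : nat}.
Implicit Types M : V -> 'M[R]_(m, n).

Lemma is_derive_mx M (D : 'M[R]_(m, n)) t v :
  (forall i j, is_derive t v (fun x => M x i j) (D i j)) -> is_derive t v M D.
Proof.
move=> h; have dM : derivable M t v by apply/derivable_mxP => i j; case: (h i j).
apply: DeriveDef => //; rewrite derive_mx//; apply/matrixP => i j.
by rewrite mxE; case: (h i j).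
Qed.

Lemma is_derive_coord M (D : 'M[R]_(m, n)) t v i j :
  is_derive t v M D -> is_derive t v (fun x => M x i j) (D i j).
Proof.
move=> [dM <-]; apply: DeriveDef; first exact: (derivable_mxP _ _ _).1.
by rewrite derive_mx// mxE.
Qed.

Lemma differentiable_mx M x :
  (forall i j, differentiable (fun y => M y i j) x) -> differentiable M x.
Proof.
move=> h; rewrite (_ : M = \sum_i \sum_j (fun y => M y i j *: delta_mx i j)).
  apply: differentiable_sum => i; apply: differentiable_sum => j.
  exact: differentiableZl.
apply/funext => y; rewrite fct_sumE {1}(matrix_sum_delta (M y)).
by apply: eq_bigr => i _; rewrite fct_sumE.
Qed.

Lemma diff_mx M x v i j : differentiable M x ->
  'd M x v i j = 'd (fun y => M y i j) x v.
Proof.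
move=> dM; have dc : differentiable (fun y => M y i j) x.
  exact: (@differentiable_comp _ _ _ _ M _ x dM (differentiable_coord (M x) i j)).
rewrite -!deriveE//.
have dMv := derivableP (@diff_derivable _ _ _ _ _ v dM).
by have [_ ->] := is_derive_coord _ _ _ _ i j dMv.
Qed.

End matrix_calculus.

Lemma is_derive_dot (R : realType) (V : normedModType R)
    (x y : V -> 'cV[R]_3) (dx dy : 'cV[R]_3) t v :
  is_derive t v x dx -> is_derive t v y dy ->
  is_derive t v (fun s => dot (x s) (y s)) (dot dx (y t) + dot (x t) dy).
Proof.
move=> hx hy.
have hi i := is_deriveM (is_derive_coord _ _ _ _ i 0 hx) (is_derive_coord _ _ _ _ i 0 hy).
have := is_derive_sum hi.
rewrite (_ : \sum_i _ = (fun s => dot (x s) (y s))); last first.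
  by apply/funext => s; rewrite fct_sumE.
move=> h; apply: is_derive_eq h _.
rewrite /dot -big_split/=; apply: eq_bigr => i _.
by rewrite addrC; congr (_ + _); exact: mulrC.
Qed.

(** * The unit normal of a level surface *)

Lemma diffM_at (R : realType) (V : normedModType R) (f g : V -> R) (x w : V) :
  differentiable f x -> differentiable g x ->
  'd (f * g) x w = f x * 'd g x w + g x * 'd f x w.
Proof. by move=> df dg; rewrite diffM. Qed.

Section level_surface.
Context {R : realType}.
Variables (O : set 'cV[R]_3) (phi : 'cV[R]_3 -> R).
Hypotheses (Oopen : open O) (phi_C1 : C1_on O phi)
  (dphi_C1 : forall i, C1_on O (partial i phi)).
Implicit Types x v w : 'cV[R]_3.

Lemma grad_dot x v : dot (grad phi x) v = 'd phi x v.
Proof.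
rewrite {2}(matrix_sum_delta v) linear_sum /dot; apply: eq_bigr => i _.
rewrite linear_sum big_ord1 linearZ mxE mulrC.
by rewrite /partial /ebasis.
Qed.

Let norm_grad x := Num.sqrt (dot (grad phi x) (grad phi x)).

Lemma nuE x i : nu phi x i 0 = (norm_grad x)^-1 * partial i phi x.
Proof. by rewrite !mxE. Qed.

Lemma dot_nu x v : dot (nu phi x) v = (norm_grad x)^-1 * dot (grad phi x) v.
Proof. exact: dotZl. Qed.

Lemma norm_grad_gt0 x : grad phi x != 0 -> 0 < norm_grad x.
Proof. by move=> /dot_gt0; rewrite sqrtr_gt0. Qed.

Lemma nu_unit x : grad phi x != 0 -> dot (nu phi x) (nu phi x) = 1.
Proof.
move=> g0; rewrite dot_nu dotC dot_nu mulrA -invfM -expr2.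
by rewrite sqr_sqrtr ?ltW ?dot_gt0// mulVf// gt_eqF// dot_gt0.
Qed.

(** A nonzero gradient keeps the square root away from its singular point and makes the inverse
    legitimate. *)
Lemma differentiable_inv_norm_grad x : O x -> grad phi x != 0 ->
  differentiable (fun y => (norm_grad y)^-1) x.
Proof.
move=> Ox g0.
have dg : differentiable (fun y => dot (grad phi y) (grad phi y)) x.
  rewrite (_ : (fun y => _) =
      \sum_i (fun y => partial i phi y * partial i phi y)); last first.
    by apply/funext => y; rewrite fct_sumE; apply: eq_bigr => i _; rewrite !mxE.
  apply: differentiable_sum => i.
  by apply: differentiableM; exact: (dphi_C1 i).1.
apply: differentiableV; last by rewrite gt_eqF// norm_grad_gt0.
apply: (@differentiable_comp _ _ _ _ _ Num.sqrt x dg).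
apply/derivable1_diffP.
by have [] := @is_derive1_sqrt R _ (dot_gt0 _ g0).
Qed.

Lemma differentiable_nu x : O x -> grad phi x != 0 -> differentiable (nu phi) x.
Proof.
move=> Ox g0; apply: differentiable_mx => i j.
rewrite (ord1 j) (_ : (fun y => _) =
    (fun y => (norm_grad y)^-1) * (fun y => partial i phi y)).
  apply: differentiableM; first exact: differentiable_inv_norm_grad.
  exact: (dphi_C1 i).1.
by apply/funext => y; rewrite nuE.
Qed.

Lemma dnu_coord x w i : O x -> grad phi x != 0 ->
  'd (nu phi) x w i 0 = (norm_grad x)^-1 * 'd (partial i phi) x w
    + partial i phi x * 'd (fun y => (norm_grad y)^-1) x w.
Proof.
move=> Ox g0; rewrite diff_mx; last exact: differentiable_nu.
have -> : (fun y => nu phi y i 0) = (fun y => (norm_grad y)^-1) * partial i phi.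
  by apply/funext => y; rewrite nuE.
apply: diffM_at; first exact: differentiable_inv_norm_grad.
exact: (dphi_C1 i).1.
Qed.

(* The derivative of the normalising factor only contributes a multiple of
   [grad phi x], which is killed by [v]. *)
Lemma dot_dnu x v w : O x -> grad phi x != 0 -> dot (grad phi x) v = 0 ->
  dot ('d (nu phi) x w) v =
  (norm_grad x)^-1 * \sum_i 'd (partial i phi) x w * v i 0.
Proof.
move=> Ox g0 gv.
have aux (N p a q b : R) : (N * p + a * q) * b = N * (p * b) + a * b * q by ring.
pose q := 'd (fun y => (norm_grad y)^-1) x w.
transitivity (\sum_i ((norm_grad x)^-1 * ('d (partial i phi) x w * v i 0)
   + partial i phi x * v i 0 * q)).
  by apply: eq_bigr => i _; rewrite -aux (dnu_coord x w i Ox g0).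
rewrite big_split/= -mulr_sumr -mulr_suml.
have -> : \sum_i partial i phi x * v i 0 = 0.
  by rewrite -[RHS]gv; apply: eq_bigr => i _; rewrite mxE.
by rewrite mul0r addr0.
Qed.

Lemma partial_sym x i j : O x ->
  'd (partial i phi) x (ebasis R j) = 'd (partial j phi) x (ebasis R i).
Proof.
move=> Ox; apply: second_derivative_sym.
- by apply: filterS phi_C1.1 _; exact: open_nbhs_nbhs.
- exact: (dphi_C1 i).1.
- exact: (dphi_C1 j).1.
Qed.

Lemma diff_partialE x i w :
  'd (partial i phi) x w = \sum_j w j 0 * 'd (partial i phi) x (ebasis R j).
Proof.
rewrite {1}(matrix_sum_delta w) linear_sum; apply: eq_bigr => j _.
by rewrite linear_sum big_ord1 linearZ.
Qed.

(** This is self-adjointness of the shape operator: on tangent vectors the form is the Hessian of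
    [phi] divided by the norm of the gradient, and the Hessian is symmetric. *)
Lemma dnu_sym x v w : O x -> grad phi x != 0 ->
  dot (grad phi x) v = 0 -> dot (grad phi x) w = 0 ->
  dot ('d (nu phi) x w) v = dot ('d (nu phi) x v) w.
Proof.
move=> Ox g0 gv gw; rewrite !dot_dnu//; congr (_ * _).
under eq_bigr do rewrite diff_partialE mulr_suml.
under [RHS]eq_bigr do rewrite diff_partialE mulr_suml.
rewrite exchange_big; apply: eq_bigr => i _; apply: eq_bigr => j _.
by rewrite (partial_sym x j i Ox); ring.
Qed.

End level_surface.

(** * Continuity and differentiation of sums and cross products *)

Lemma continuous_sum_at (R : realType) (T : topologicalType) n
    (F : 'I_n -> T -> R) (t : T) :
  (forall i, {for t, continuous (F i)}) ->
  {for t, continuous (fun x => \sum_i F i x)}.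
Proof.
move=> cF; apply: (@cvg_big R _ +%R 0 predT _ T (nbhs t) _ F (F^~ t)) => [|i _].
- move=> z; apply: cvgD; [exact: cvg_fst|exact: cvg_snd].
- exact: cF.
Qed.

Lemma is_derive_cross (R : realType) (V : normedModType R)
    (x y : V -> 'cV[R]_3) (dx dy : 'cV[R]_3) t v :
  is_derive t v x dx -> is_derive t v y dy ->
  is_derive t v (fun s => cross (x s) (y s))
    (cross dx (y t) + cross (x t) dy).
Proof.
move=> hx hy; apply: is_derive_mx => k j; rewrite (ord1 j) {j}.
have hxy i j := is_deriveM (is_derive_coord _ _ _ _ i 0 hx)
  (is_derive_coord _ _ _ _ j 0 hy).
(* Each coordinate of a cross product is a 2 by 2 minor, so one computation serves all three. *)
have minor i j (F : V -> R) (D : R) :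
    F = (fun s => x s i 0 * y s j 0 - x s j 0 * y s i 0) ->
    D = dx i 0 * y t j 0 - dx j 0 * y t i 0
        + (x t i 0 * dy j 0 - x t j 0 * dy i 0) -> is_derive t v F D.
  move=> -> ->; apply: is_derive_eq (is_deriveB (hxy i j) (hxy j i)) _.
  have aux (a b c d a' b' c' d' : R) :
      a * b + c * d - (a' * b' + c' * d') = d * c - d' * c' + (a * b - a' * b').
    by ring.
  exact: aux.
have fE (i : 'I_3) (h : V -> R) : (forall s, cross (x s) (y s) i 0 = h s) ->
    (fun s => cross (x s) (y s) i 0) = h by move=> H; exact/funext.
move: k; apply: forall_I3.
- by apply: (minor i1 i2); [apply: fE => s|]; rewrite ?mxE.
- by apply: (minor i2 i0); [apply: fE => s|]; rewrite ?mxE.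
- by apply: (minor i0 i1); [apply: fE => s|]; rewrite ?mxE.
Qed.

Lemma continuous_cross_cst (R : realType) (T : topologicalType)
    (f : T -> 'cV[R]_3) (w : 'cV[R]_3) (i : 'I_3) (t : T) :
  {for t, continuous f} -> {for t, continuous (fun s => cross (f s) w i 0)}.
Proof.
move=> cf.
have cfi j : {for t, continuous (fun s => f s j 0)}.
  exact: (@continuous_comp _ _ _ f (fun M : 'cV[R]_3 => M j 0) t cf
    (@coord_continuous _ _ _ j 0 (f t))).
have minor j k (F : T -> R) : F = (fun s => f s j 0 * w k 0 - f s k 0 * w j 0) ->
    {for t, continuous F}.
  move=> ->; apply: continuousB; apply: continuousM;
    try exact: cfi; exact: cst_continuous.
move: i; apply: forall_I3.
- by apply: (minor i1 i2); apply/funext => s; rewrite mxE.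
- by apply: (minor i2 i0); apply/funext => s; rewrite mxE.
- by apply: (minor i0 i1); apply/funext => s; rewrite mxE.
Qed.

(** * Normal and curvature of a cylinder *)

Section cylinder.
Context {R : realType}.
Variables (O : set 'cV[R]_3) (phi lam : 'cV[R]_3 -> R) (e : 'cV[R]_3).
Hypotheses (ee : dot e e = 1) (cyl : cylinder_surface O phi e).
Hypothesis shapeE : forall x, surf O phi x ->
  shape_op phi x (tau phi e x) = lam x *: tau phi e x.

Lemma cylinder_grad_neq0 x : surf O phi x -> grad phi x != 0.
Proof. by case: cyl => _ _ _ h _; exact: h. Qed.

Lemma cylinder_line x s : surf O phi x -> surf O phi (x + s *: e).
Proof. by case: cyl => _ _ _ _ h; exact: h. Qed.

(** The function [phi] vanishes along the whole ruling through [x], hence so does its derivative in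
    direction [e]. *)
Lemma cylinder_grad_e x : surf O phi x -> dot (grad phi x) e = 0.
Proof.
case: cyl => Oopen C1phi _ _ _ Sx; rewrite grad_dot.
have x0 : x + 0 *: e = x by rewrite scale0r addr0.
have : is_derive (0 : R) 1 (fun s => phi (x + s *: e)) ('d phi (x + 0 *: e) e).
  by apply: is_derive_line; rewrite x0; exact: C1phi.1 Sx.1.
rewrite (_ : (fun s => _) = cst 0).
  by rewrite x0 => -[_ <-]; rewrite derive_cst.
by apply/funext => s; exact: (cylinder_line x s Sx).2.
Qed.

Lemma cylinder_nu_unit x : surf O phi x -> dot (nu phi x) (nu phi x) = 1.
Proof. by move/cylinder_grad_neq0; exact: nu_unit. Qed.

Lemma cylinder_nu_e x : surf O phi x -> dot (nu phi x) e = 0.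
Proof. by move=> Sx; rewrite dot_nu cylinder_grad_e// mulr0. Qed.

Lemma cylinder_differentiable_nu x : surf O phi x -> differentiable (nu phi) x.
Proof.
case: cyl => _ _ C1dphi _ _ Sx.
by apply: differentiable_nu C1dphi _ Sx.1 _; exact: cylinder_grad_neq0.
Qed.

Lemma dnu_tau x : surf O phi x ->
  'd (nu phi) x (tau phi e x) = - (lam x *: tau phi e x).
Proof. by move=> Sx; rewrite -shapeE// /shape_op opprK. Qed.

Lemma grad_tau x : dot (grad phi x) (tau phi e x) = 0.
Proof.
by rewrite dotC dot_crossl dotE !crossE !mxE; ring.
Qed.

(* The rulings are lines of curvature: along [x + s e] the normal stays a unit
   vector orthogonal to [e], and its [tau]-component vanishes because the shape
   operator is symmetric and has [tau] as an eigenvector. *)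
Lemma dnu_e x : surf O phi x -> 'd (nu phi) x e = 0.
Proof.
move=> Sx; have [Oopen C1phi C1dphi _ _] := cyl.
have x0 : x + 0 *: e = x by rewrite scale0r addr0.
have hd : is_derive (0 : R) 1 (fun s => nu phi (x + s *: e)) ('d (nu phi) x e).
  have := @is_derive_line _ _ _ (nu phi) x e 0; rewrite x0; apply.
  exact: cylinder_differentiable_nu.
have dn : dot ('d (nu phi) x e) (nu phi x) = 0.
  have := is_derive_dot _ _ _ _ _ _ _ _ hd hd.
  rewrite (_ : (fun s => _) = cst 1); last first.
    by apply/funext => s; apply: cylinder_nu_unit; exact: cylinder_line.
  rewrite x0 => -[_]; rewrite derive_cst [dot (nu phi x) _]dotC => /esym/eqP.
  by rewrite -mulr2n mulrn_eq0 /= => /eqP.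
have de : dot ('d (nu phi) x e) e = 0.
  have := is_derive_dot _ _ _ _ _ _ _ _ hd (is_derive_cst e (0 : R) 1).
  rewrite (_ : (fun s => _) = cst 0); last first.
    by apply/funext => s; apply: cylinder_nu_e; exact: cylinder_line.
  move=> -[_]; rewrite derive_cst => ->.
  by rewrite [X in _ = _ + X]dotC dot0l addr0.
have dt : dot ('d (nu phi) x e) (tau phi e x) = 0.
  rewrite (dnu_sym O phi Oopen C1phi C1dphi).
  - rewrite dnu_tau// dotNl dotZl /tau frame_dot_ne_e mulr0 oppr0//.
  - exact: Sx.1.
  - exact: cylinder_grad_neq0.
  - exact: grad_tau.
  - exact: cylinder_grad_e.
rewrite (frame_decomp (nu phi x) e (cylinder_nu_unit x Sx) ee (cylinder_nu_e x Sx)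
  ('d (nu phi) x e)).
by rewrite dn de -/(tau phi e x) dt !scale0r !addr0.
Qed.

(** A tangent vector has only an [e]- and a [tau]-component; the differential of the normal kills
    the first and scales the second by [- lam x]. *)
Lemma dnu_tangent x u : surf O phi x -> dot u (nu phi x) = 0 ->
  'd (nu phi) x u = - (lam x * dot u (tau phi e x)) *: tau phi e x.
Proof.
move=> Sx un.
rewrite {1}(frame_decomp (nu phi x) e (cylinder_nu_unit x Sx) ee (cylinder_nu_e x Sx) u).
rewrite un scale0r add0r linearD linearZ linearZ /= dnu_e// scaler0 add0r.
by rewrite dnu_tau// scalerN scalerA scaleNr mulrC.
Qed.

(** The curvature [lam] is given only through the eigenvalue equation on the surface. Its continuity
    along a curve, required to integrate it, comes from an explicit formula in the second
    derivatives of [phi]. *)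
Lemma lam_continuous (a : R -> 'cV[R]_3) (t : R) :
  (\forall s \near t, surf O phi (a s)) -> {for t, continuous a} ->
  {for t, continuous (fun s => lam (a s))}.
Proof.
move=> Sa ca; have [Oopen C1phi C1dphi _ _] := cyl.
have Sat : surf O phi (a t) := nbhs_singleton Sa.
(* The second fundamental form evaluated at [tau], written by a formula that also makes sense off
   the surface, where [lam] is arbitrary. *)
pose K x := - ((Num.sqrt (dot (grad phi x) (grad phi x)))^-1 *
  \sum_i (\sum_j tau phi e x j 0 * 'd (partial i phi) x (ebasis R j))
         * tau phi e x i 0).
have lamK x : surf O phi x -> lam x = K x.
  move=> Sx; have := frame_dot_ne_ne _ _ (cylinder_nu_unit x Sx) ee (cylinder_nu_e x Sx).
  rewrite -/(tau phi e x) => tt.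
  have := dnu_tau x Sx => /(congr1 (fun w => dot w (tau phi e x))).
  rewrite dotNl dotZl tt mulr1 => /(congr1 -%R); rewrite opprK => <-.
  rewrite (dot_dnu O phi C1dphi)//; last 3 first.
  - exact: Sx.1.
  - exact: cylinder_grad_neq0.
  - exact: grad_tau.
  congr (- (_ * _)); apply: eq_bigr => i _; congr (_ * _).
  exact: diff_partialE.
have ctau j : {for a t, continuous (fun x => tau phi e x j 0)}.
  apply: continuous_cross_cst; apply: differentiable_continuous.
  exact: cylinder_differentiable_nu.
have cK : {for a t, continuous K}.
  apply: continuousN; apply: continuousM.
    apply: differentiable_continuous.
    apply: (differentiable_inv_norm_grad O phi C1dphi) => //; first exact: Sat.1.
    exact: cylinder_grad_neq0.
  apply: continuous_sum_at => i; apply: continuousM; last exact: ctau.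
  apply: continuous_sum_at => j; apply: continuousM; first exact: ctau.
  exact: (C1dphi i).2 Sat.1.
have cKa : {for t, continuous (K \o a)} by exact: continuous_comp.
suff : lam (a s) @[s --> t] --> lam (a t) by [].
rewrite lamK//; apply: cvg_trans cKa.
by apply: near_eq_cvg; apply: filterS Sa => s /lamK.
Qed.

End cylinder.

(** * Integration on an open interval *)

Lemma near_itvoo (R : realType) (t0 t1 t : R) : t0 < t < t1 ->
  \forall s \near t, t0 < s < t1.
Proof.
move=> /andP[t0t tt1]; near=> s; apply/andP; split; near: s.
  exact: lt_nbhsr.
exact: lt_nbhsl.
Unshelve. all: by end_near. Qed.

(** Both endpoints are interior to the open interval, so [F] is differentiable, hence continuous,
    there as well. The degenerate case [x = y] is separate because the fundamental theorem is
    applied with [x < y]. *)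
Lemma integral_FTC (R : realType) (t0 t1 : R) (F f : R -> R) (x y : R) :
  (forall s, t0 < s < t1 -> is_derive s 1 F (f s)) ->
  (forall s, t0 < s < t1 -> {for s, continuous f}) ->
  t0 < x -> x <= y -> y < t1 ->
  Rintegral lebesgue_measure `[x, y] f = F y - F x.
Proof.
move=> dF cf t0x; rewrite le_eqVlt => /predU1P[->|xy] yt1.
  by rewrite subrr set_itv1 Rintegral_set1.
have I s : x <= s <= y -> t0 < s < t1.
  by move=> /andP[xs sy]; rewrite (lt_le_trans t0x xs) (le_lt_trans sy yt1).
have dFs s : x <= s <= y -> derivable F s 1 by move=> /I/dF[].
have cF s : x <= s <= y -> {for s, continuous F}.
  by move=> /dFs/derivable1_diffP; exact: differentiable_continuous.
rewrite /Rintegral (@continuous_FTC2 _ f F x y xy)//.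
- apply: continuous_in_subspaceT => s; rewrite inE/= in_itv/= => /I.
  exact: cf.
- split.
  + by move=> s /subset_itv_oo_cc; rewrite in_itv/=; exact: dFs.
  + by apply: cvg_at_right_filter; apply: cF; rewrite lexx ltW.
  + by apply: cvg_at_left_filter; apply: cF; rewrite lexx ltW.
- move=> s /subset_itv_oo_cc; rewrite in_itv/= => /I/dF[_ <-].
  exact: derive1E.
Qed.

Lemma oint_FTC (R : realType) (t0 t1 : R) (F f : R -> R) (x y : R) :
  (forall s, t0 < s < t1 -> is_derive s 1 F (f s)) ->
  (forall s, t0 < s < t1 -> {for s, continuous f}) ->
  t0 < x < t1 -> t0 < y < t1 -> oint f x y = F y - F x.
Proof.
move=> dF cf /andP[t0x xt1] /andP[t0y yt1]; rewrite /oint.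
case: ifPn => [xy|]; first exact: integral_FTC xy yt1.
rewrite -ltNge => /ltW yx.
by rewrite (integral_FTC _ _ _ _ _ _ _ dF cf t0y yx xt1) opprB.
Qed.

(** This is the oriented fundamental theorem with integrand 0. *)
Lemma derive0_constant (R : realType) (t0 t1 : R) (F : R -> R) (x y : R) :
  (forall s, t0 < s < t1 -> is_derive s 1 F 0) ->
  t0 < x < t1 -> t0 < y < t1 -> F y = F x.
Proof.
move=> dF xI yI; apply/eqP; rewrite -subr_eq0.
rewrite -(oint_FTC _ _ _ _ _ _ _ dF _ xI yI); last first.
  by move=> s _; exact: cst_continuous.
by rewrite /oint !Rintegral_cst//= !mul0r oppr0 if_same.
Qed.

(** * Skew matrices and angular velocity *)

Section cross_matrix.
Context {R : realType}.
Implicit Types (M : 'M[R]_3) (w v x : 'cV[R]_3).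

(** The axial vector of a skew matrix. Being a mere selection of entries, it commutes with
    differentiation. *)
Definition vee M : 'cV[R]_3 :=
  \col_(i < 3) nth 0 [:: M i2 i1; M i0 i2; M i1 i0] i.

Definition hat w : 'M[R]_3 :=
  \matrix_(i, j) cross w (ebasis R j) i 0.

Lemma veeE M : (vee M i0 0 = M i2 i1) * (vee M i1 0 = M i0 i2)
  * (vee M i2 0 = M i1 i0).
Proof. by rewrite !mxE. Qed.

Lemma ebasisE :
  ((ebasis R i0 i0 0 = 1) * (ebasis R i0 i1 0 = 0) * (ebasis R i0 i2 0 = 0)) *
  ((ebasis R i1 i0 0 = 0) * (ebasis R i1 i1 0 = 1) * (ebasis R i1 i2 0 = 0)) *
  ((ebasis R i2 i0 0 = 0) * (ebasis R i2 i1 0 = 0) * (ebasis R i2 i2 0 = 1)).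
Proof. by rewrite !mxE. Qed.

Lemma hatE w :
  ((hat w i0 i0 = 0) * (hat w i0 i1 = - w i2 0) * (hat w i0 i2 = w i1 0)) *
  ((hat w i1 i0 = w i2 0) * (hat w i1 i1 = 0) * (hat w i1 i2 = - w i0 0)) *
  ((hat w i2 i0 = - w i1 0) * (hat w i2 i1 = w i0 0) * (hat w i2 i2 = 0)).
Proof.
have E i j : hat w i j = cross w (ebasis R j) i 0 by rewrite mxE.
by rewrite !E !crossE !ebasisE !mulr0 !mulr1 !subr0 !sub0r.
Qed.

Lemma vee_hat w : vee (hat w) = w.
Proof. by apply: vecP; rewrite !veeE !hatE. Qed.

Lemma hat_mul w x : hat w *m x = cross w x.
Proof.
by apply: vecP; rewrite mxE sum3E !hatE crossE; ring.
Qed.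

Lemma vee_cross M w : (forall x, M *m x = cross w x) -> vee M = w.
Proof.
move=> h; rewrite -[RHS]vee_hat; congr vee; apply/matrixP => i j.
by rewrite [RHS]mxE -h /ebasis -colE mxE.
Qed.

Lemma skewE M i j : Defs.skew M -> M i j = - M j i.
Proof. by move=> /matrixP/(_ j i); rewrite !mxE. Qed.

Lemma skew_hat w : Defs.skew (hat w).
Proof.
apply/matrixP => i j; rewrite [LHS]mxE [RHS]mxE; move: i j.
by apply: forall_I3; apply: forall_I3; rewrite !hatE ?oppr0 ?opprK.
Qed.

(** Each component of the axial vectors occurs in two off-diagonal entries, whence the 2; it cancels
    the 1/2 in the rotational part of the metric. *)
Lemma trace_hat M v : Defs.skew M -> \tr (M *m (hat v)^T) = 2 * dot (vee M) v.
Proof.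
move=> sM; rewrite /mxtrace sum3E !mxE !sum3E ![_^T _ _]mxE !hatE dotE !veeE.
by rewrite (skewE M i0 i1 sM) (skewE M i2 i0 sM) (skewE M i1 i2 sM); ring.
Qed.

End cross_matrix.

Lemma is_derive_vee (R : realType) (M : R -> 'M[R]_3) (t : R) :
  derivable M t 1 ->
  is_derive t 1 (fun s => vee (M s)) (vee (derive1 M t)).
Proof.
move=> /derivableP dM; apply: is_derive_mx => i j; rewrite derive1E.
have h k l := is_derive_coord _ _ _ _ k l dM.
have red k l (F : R -> R) (D : R) : F = (fun s => M s k l) ->
    D = ('D_1 M t) k l -> is_derive t 1 F D by move=> -> ->.
move: i; apply: forall_I3.
- by apply: (red i2 i1); [apply/funext => s|]; rewrite !mxE.
- by apply: (red i0 i2); [apply/funext => s|]; rewrite !mxE.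
- by apply: (red i1 i0); [apply/funext => s|]; rewrite !mxE.
Qed.

(** * Rolling motion *)

(* Testing the reaction against [n], [e] and [t = n x e] in turn, the balance
   of moments is solved for [dw . e], [dw . n] and [du . e]. *)
Lemma rolling_equations (R : realType) (r gam g l : R)
    (n e w dw u dn du : 'cV[R]_3) :
  dot n n = 1 -> dot e e = 1 -> dot n e = 0 -> 0 < r -> 0 < gam ->
  u = r *: cross w n ->
  dn = - (l * dot u (cross n e)) *: cross n e ->
  du = r *: (cross dw n + cross w dn) ->
  (forall v, r * gam ^+ 2 * dot dw v + dot du (cross v n)
    + g * dot e (cross v n) = 0) ->
  [/\ dot dw e = 0,
      dot du e + gam ^+ 2 / (1 + gam ^+ 2) * r ^+ 2 * l * dot w e * dot w n
        + g / (1 + gam ^+ 2) = 0 &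
      dot dw n + dot w dn = l * dot w e * dot u e].
Proof.
move=> nn ee ne r0 gam0 uE dnE duE newton; set t := cross n e in dnE.
have tn := frame_cross_ne_n n e nn ne; rewrite -/t in tn.
have te := frame_cross_ne_e n e ee ne; rewrite -/t in te.
have tde := frame_dot_ne_e n e; rewrite -/t in tde.
have tdt := frame_dot_ne_ne n e nn ee ne; rewrite -/t in tdt.
have en : cross e n = - t by rewrite crossN.
have nt : cross n t = - e by rewrite crossN tn.
have dotNr (a b : 'cV[R]_3) : dot a (- b) = - dot a b by rewrite dotC dotNl dotC.
have dotZr k (a b : 'cV[R]_3) : dot a (k *: b) = k * dot a b by rewrite dotC dotZl dotC.
have dot0r (a : 'cV[R]_3) : dot a 0 = 0 by rewrite dotC dot0l.
have ut : dot u t = - (r * dot w e).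
  by rewrite uE dotZl dot_crossl nt dotNr mulrN.
have ue : dot u e = r * dot w t by rewrite uE dotZl dot_crossl.
(* By rolling, the speed along [t] is [- r * dot w e], so the spin about the axis alone decides how
   fast the normal turns. *)
have dn' : dn = (l * r * dot w e) *: t.
  by rewrite dnE ut; congr (_ *: _); ring.
have dut : dot du t = - (r * dot dw e).
  rewrite duE dotZl dotDl !dot_crossl nt dn' crossZl crossvv scaler0 dot0r addr0.
  by rewrite dotNr mulrN.
have due : dot du e = r * (dot dw t - l * r * dot w e * dot w n).
  by rewrite duE dotZl dotDl !dot_crossl dn' crossZl te scalerN dotNr dotZr.
(* Since [n x n = 0], [t x n = e] and [e x n = - t], the three tests isolate [dot dw n], then
   [dot dw t] with [dot du e] and gravity, then [dot dw e] with [dot du t], which is itself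
   [- r * dot dw e]. *)
have := newton n; rewrite crossvv !dot0r mulr0 !addr0 => En.
have := newton t; rewrite tn ee mulr1 => Et.
have := newton e; rewrite en !dotNr (dotC e t) tde dut oppr0 mulr0 addr0 opprK => Ee.
have g0 : 0 < 1 + gam ^+ 2 by rewrite ltr_wpDr// sqr_ge0.
have r1 : r != 0 by rewrite gt_eqF.
split.
- have : r * (1 + gam ^+ 2) * dot dw e = 0 by rewrite -[RHS]Ee; ring.
  by move/eqP; rewrite !mulf_eq0 (negPf r1) (gt_eqF g0) /= => /eqP.
- have g1 : 1 + gam ^+ 2 != 0 by rewrite gt_eqF.
  (* The differentiated constraint eliminates [dot dw t] from [Et]; collecting [dot du e] produces
     the factor [1 + gam ^+ 2]. *)
  have rdt : r * dot dw t = dot du e + r ^+ 2 * l * dot w e * dot w n.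
    by rewrite due; ring.
  have := Et; rewrite mulrAC rdt => E.
  apply: (mulfI g1); rewrite mulr0 -[RHS]E; field.
  by rewrite g1.
(* As [dot dw n] vanishes, the normal spin changes only through the turning of the normal. *)
- move/eqP: En; rewrite !mulf_eq0 (negPf r1) (gt_eqF gam0) /= => /eqP ->.
  by rewrite dn' dotZr ue add0r; ring.
Qed.

Section rolling.
Context {R : realType}.
Variables (r m gam g : R) (e : 'cV[R]_3) (O : set 'cV[R]_3)
  (phi lam : 'cV[R]_3 -> R) (t0 t1 : R) (A : R -> 'M[R]_3)
  (a omega : R -> 'cV[R]_3).
Hypotheses (r0 : 0 < r) (m0 : 0 < m) (gam0 : 0 < gam) (ee : dot e e = 1)
  (cyl : cylinder_surface O phi e).
Hypothesis shapeE : forall x, surf O phi x ->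
  shape_op phi x (tau phi e x) = lam x *: tau phi e x.
Hypothesis newton :
  constrained_newton r m gam g e O phi [set t | t0 < t < t1] A a.
Hypothesis omegaE : forall t x, t0 < t < t1 -> angU A t *m x = cross (omega t) x.

Let dw t := vee (derive1 (angU A) t).

Lemma rolling_surf t : t0 < t < t1 -> surf O phi (a t).
Proof. by move=> /newton[[]]. Qed.

Lemma is_derive_position t : t0 < t < t1 -> is_derive t 1 a (vel a t).
Proof.
by move=> /newton[_ [_ /derivableP da] _ _ _]; rewrite /vel derive1E.
Qed.

Lemma is_derive_velocity t : t0 < t < t1 ->
  is_derive t 1 (vel a) (derive1 (vel a) t).
Proof.
by move=> /newton[_ _ [_ /derivableP da] _ _]; rewrite derive1E.
Qed.

(** On the open interval [omega] is the axial vector of [angU A], whose derivability is part of the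
    equation of motion; differentiation is local, so the agreement there suffices. *)
Lemma is_derive_omega t : t0 < t < t1 -> is_derive t 1 omega (dw t).
Proof.
move=> It; have [_ _ [dU _] _ _] := newton t It.
apply: near_eq_is_derive (is_derive_vee _ (angU A) t dU).
apply: filterS (near_itvoo _ _ _ _ It) => s Is.
by apply: vee_cross => x; exact: omegaE.
Qed.

Lemma rolling_velocity t : t0 < t < t1 ->
  vel a t = r *: cross (omega t) (nu phi (a t)).
Proof. by move=> It; have [_ _ _ [_ /= ->] _] := newton t It; rewrite omegaE. Qed.

Lemma velocity_tangent t : t0 < t < t1 -> dot (vel a t) (nu phi (a t)) = 0.
Proof.
by move=> It; rewrite rolling_velocity// dotZl dot_crossl crossvv dotC dot0l mulr0.
Qed.

Lemma is_derive_nu t : t0 < t < t1 ->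
  is_derive t 1 (fun s => nu phi (a s))
    (- (lam (a t) * dot (vel a t) (tau phi e (a t))) *: tau phi e (a t)).
Proof.
move=> It; have Sa := rolling_surf t It.
rewrite -(dnu_tangent O phi lam e ee cyl shapeE _ _ Sa (velocity_tangent t It)).
apply: is_derive_curve (is_derive_position t It) _.
exact: (cylinder_differentiable_nu O phi e).
Qed.

Lemma acceleration t : t0 < t < t1 ->
  derive1 (vel a) t = r *: (cross (dw t) (nu phi (a t)) + cross (omega t)
    (- (lam (a t) * dot (vel a t) (tau phi e (a t))) *: tau phi e (a t))).
Proof.
move=> It; rewrite derive1E.
have H := is_derive_cross _ _ _ _ _ _ _ _ (is_derive_omega t It) (is_derive_nu t It).
have : is_derive t 1 (vel a) (r *: (cross (dw t) (nu phi (a t)) + cross (omega t)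
    (- (lam (a t) * dot (vel a t) (tau phi e (a t))) *: tau phi e (a t)))).
  apply: near_eq_is_derive (is_deriveZ r H).
  by apply: filterS (near_itvoo _ _ _ _ It) => s Is; rewrite rolling_velocity.
by case.
Qed.

(* D'Alembert's principle tested against the infinitesimal rolling motion with
   angular velocity [v]. *)
Lemma newton_tested t v : t0 < t < t1 ->
  r * gam ^+ 2 * dot (dw t) v + dot (derive1 (vel a) t) (cross v (nu phi (a t)))
    + g * dot e (cross v (nu phi (a t))) = 0.
Proof.
move=> It; have [_ _ _ _ [[/= sU _] perp]] := newton t It.
rewrite subr0 in sU.
(* The no-slip constraint forces the translational part of the test motion once [v] is chosen. *)
have := perp (hat v, r *: cross v (nu phi (a t))).
rewrite /noslip /metric /= hat_mul subr0 => /(_ (conj (skew_hat v) erefl)).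
rewrite trace_hat// -/(dw t) [dot _ (r *: _)]dotC dotZl [dot (cross _ _) _]dotC.
have vn : dot (nu phi (a t)) (cross v (nu phi (a t))) = 0.
  by rewrite dotC dot_crossl crossvv dotC dot0l.
rewrite /tproj !dotBl [dot (_ *: nu _ _) _]dotZl vn mulr0 subr0.
rewrite [dot (m^-1 *: _) _]dotZl [dot (- (m * g) *: _) _]dotZl.
move/eqP; rewrite mulf_eq0 (gt_eqF m0) /= => /eqP E.
apply: (mulfI (lt0r_neq0 r0)); rewrite mulr0 -[RHS]E; field.
by rewrite lt0r_neq0.
Qed.

Lemma rolling_equations_at t : t0 < t < t1 ->
  [/\ dot (dw t) e = 0,
      dot (derive1 (vel a) t) e
        + gam ^+ 2 / (1 + gam ^+ 2) * r ^+ 2 * lam (a t) * dot (omega t) e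
          * dot (omega t) (nu phi (a t)) + g / (1 + gam ^+ 2) = 0 &
      dot (dw t) (nu phi (a t)) + dot (omega t)
        (- (lam (a t) * dot (vel a t) (tau phi e (a t))) *: tau phi e (a t))
      = lam (a t) * dot (omega t) e * dot (vel a t) e].
Proof.
move=> It; have Sa := rolling_surf t It.
apply: (rolling_equations R r) => //.
- exact: (cylinder_nu_unit O phi e).
- exact: (cylinder_nu_e O phi e).
- exact: rolling_velocity.
- exact: acceleration.
- by move=> v; exact: newton_tested.
Qed.

Lemma is_derive_dot_cst (x : R -> 'cV[R]_3) (dx w : 'cV[R]_3) (t : R) :
  is_derive t 1 x dx -> is_derive t 1 (fun s => dot (x s) w) (dot dx w).
Proof.
move=> dx'; have := is_derive_dot _ _ _ _ _ _ _ _ dx' (is_derive_cst w t (1 : R)).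
by rewrite [dot (x t) 0]dotC dot0l addr0.
Qed.

Lemma is_derive_omega_nu t : t0 < t < t1 ->
  is_derive t 1 (fun s => dot (omega s) (nu phi (a s)))
    (lam (a t) * dot (omega t) e * dot (vel a t) e).
Proof.
move=> It; have [_ _ <-] := rolling_equations_at t It.
exact: is_derive_dot (is_derive_omega t It) (is_derive_nu t It).
Qed.

Lemma derive1_height t : t0 < t < t1 ->
  derive1 (fun s => dot (a s) e) t = dot (vel a t) e.
Proof.
move=> It; rewrite derive1E.
by have [_ ->] := is_derive_dot_cst _ _ e _ (is_derive_position t It).
Qed.

Lemma derive1_velocity_e t : t0 < t < t1 ->
  derive1 (fun s => dot (vel a s) e) t = dot (derive1 (vel a) t) e.
Proof.
move=> It; rewrite derive1E.
by have [_ ->] := is_derive_dot_cst _ _ e _ (is_derive_velocity t It).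
Qed.

Lemma omega_e_constant s t : t0 < s < t1 -> t0 < t < t1 ->
  dot (omega t) e = dot (omega s) e.
Proof.
apply: (derive0_constant R t0 t1 (fun s => dot (omega s) e)) => x Ix.
have [<- _ _] := rolling_equations_at x Ix.
exact: is_derive_dot_cst (is_derive_omega x Ix).
Qed.

(** Continuity of the integrand, as the fundamental theorem of calculus requires. *)
Lemma lam_velocity_continuous t : t0 < t < t1 ->
  {for t, continuous (fun s => lam (a s) * dot (vel a s) e)}.
Proof.
move=> It; apply: continuousM.
  apply: (lam_continuous O phi lam e ee cyl shapeE).
    by apply: filterS (near_itvoo _ _ _ _ It) => s; exact: rolling_surf.
  apply/differentiable_continuous/derivable1_diffP.
  by have [] := is_derive_position t It.
apply/differentiable_continuous/derivable1_diffP.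
by have [] := is_derive_dot_cst _ _ e _ (is_derive_velocity t It).
Qed.

Lemma lam_height_continuous t : t0 < t < t1 ->
  {for t, continuous (fun s => lam (a s) * derive1 (fun s => dot (a s) e) s)}.
Proof.
move=> It.
suff : lam (a s) * derive1 (fun s => dot (a s) e) s @[s --> t] -->
    lam (a t) * derive1 (fun s => dot (a s) e) t by [].
rewrite derive1_height//; apply: cvg_trans (lam_velocity_continuous t It).
apply: near_eq_cvg; apply: filterS (near_itvoo _ _ _ _ It) => s Is.
by rewrite derive1_height.
Qed.

Lemma omega_nu_integral s t : t0 < s < t1 -> t0 < t < t1 ->
  dot (omega t) (nu phi (a t)) = dot (omega s) (nu phi (a s))
    + dot (omega s) e
      * oint (fun s => lam (a s) * derive1 (fun s => dot (a s) e) s) s t.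
Proof.
move=> Is It; set c := dot (omega s) e.
pose F x := dot (omega x) (nu phi (a x)).
have dF x : t0 < x < t1 ->
    is_derive x 1 F (c * (lam (a x) * derive1 (fun s => dot (a s) e) x)).
  move=> Ix; rewrite derive1_height//.
  apply: is_derive_eq (is_derive_omega_nu x Ix) _.
  by rewrite (omega_e_constant _ _ Is Ix) -/c; ring.
(* Dividing [F] by the constant [c] gives a primitive of exactly the integrand in the statement; if
   [c] vanishes, [F] is constant. *)
rewrite -/(F t) -/(F s); have [c0|c0] := eqVneq c 0.
  rewrite c0 mul0r addr0; apply: (derive0_constant R t0 t1 F s t) => // x Ix.
  by apply: is_derive_eq (dF x Ix) _; rewrite c0 mul0r.
have dcF x : t0 < x < t1 -> is_derive x 1 (fun x => c^-1 * F x)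
    (lam (a x) * derive1 (fun s => dot (a s) e) x).
  move=> Ix; have dcFx := @is_deriveZ _ _ _ _ c^-1 _ _ _ (dF x Ix).
  apply: is_derive_eq dcFx _.
  by rewrite -[LHS]/(c^-1 * _) mulKf.
have -> := oint_FTC R t0 t1 _ _ _ _ dcF lam_height_continuous Is It.
by rewrite -mulrBr mulVKf// addrC subrK.
Qed.

(** The bracket is [dot (omega t) (nu phi (a t))] in integrated form and the axial spin is
    conserved, so this is the evolution equation for [dot u e] with the angular velocity expressed
    by its value at a base time [s]. *)
Lemma height_equation s t : t0 < s < t1 -> t0 < t < t1 ->
  derive1 (derive1 (fun s => dot (a s) e)) t
    + gam ^+ 2 / (1 + gam ^+ 2) * r ^+ 2 * lam (a t) * dot (omega s) e
      * (dot (omega s) (nu phi (a s)) + dot (omega s) e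
         * oint (fun s => lam (a s) * derive1 (fun s => dot (a s) e) s) s t)
    + g / (1 + gam ^+ 2) = 0.
Proof.
move=> Is It; rewrite -omega_nu_integral//.
(* The identity between the derivative of the height and [dot (vel a t) e] is known only inside the
   interval, which is open and so suffices to differentiate it once more. *)
have -> : derive1 (derive1 (fun s => dot (a s) e)) t =
    dot (derive1 (vel a) t) e.
  rewrite -derive1_velocity_e// !derive1E; apply: near_eq_derive.
  apply: filterS (near_itvoo _ _ _ _ It) => x Ix; exact: derive1_height.
rewrite -(omega_e_constant _ _ Is It).
by have [] := rolling_equations_at t It.
Qed.

End rolling.


Theorem theorem4p3 (R : realType) (r m gam g : R) (e : 'cV[R]_3)
    (O : set 'cV[R]_3) (phi : 'cV[R]_3 -> R) (lam : 'cV[R]_3 -> R)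
    (t0 t1 : R) (A : R -> 'M[R]_3) (a : R -> 'cV[R]_3) (omega : R -> 'cV[R]_3) :
  0 < r -> 0 < m -> 0 < gam -> dot e e = 1 ->
  cylinder_surface O phi e ->
  (forall x, surf O phi x -> shape_op phi x (tau phi e x) = lam x *: tau phi e x) ->
  t0 < 0 < t1 ->
  constrained_newton r m gam g e O phi [set t | t0 < t < t1] A a ->
  (forall t x, t0 < t < t1 -> angU A t *m x = cross (omega t) x) ->
  [/\ (forall t, t0 < t < t1 -> dot (omega t) e = dot (omega 0) e),
      (forall t, t0 < t < t1 ->
         derive1 (fun s => dot (vel a s) e) t
         + gam ^+ 2 / (1 + gam ^+ 2) * r ^+ 2 * lam (a t)
             * dot (omega t) e * dot (omega t) (nu phi (a t))
         + g / (1 + gam ^+ 2) = 0),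
      (forall t, t0 < t < t1 ->
         derivable (fun s => dot (omega s) (nu phi (a s))) t 1 /\
         derive1 (fun s => dot (omega s) (nu phi (a s))) t
           = lam (a t) * dot (omega t) e * dot (vel a t) e) &
      (forall t, t0 < t < t1 ->
         let h := fun s => dot (a s) e in
         derive1 h t = dot (vel a t) e /\
         derive1 (derive1 h) t
         + gam ^+ 2 / (1 + gam ^+ 2) * r ^+ 2 * lam (a t) * dot (omega 0) e
             * (dot (omega 0) (nu phi (a 0))
                + dot (omega 0) e * oint (fun s => lam (a s) * derive1 h s) 0 t)
         + g / (1 + gam ^+ 2) = 0)].
Proof.
move=> r0 m0 gam0 ee cyl shapeE t00 newton omegaE; split=> t It.
- exact: (omega_e_constant r m gam g e O phi lam t0 t1 A a).
- rewrite (derive1_velocity_e r m gam g e O phi t0 t1 A)//.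
  by have [] := rolling_equations_at r m gam g e O phi lam t0 t1 A a omega
    r0 m0 gam0 ee cyl shapeE newton omegaE t It.
- have [d dE] := is_derive_omega_nu r m gam g e O phi lam t0 t1 A a omega
    r0 m0 gam0 ee cyl shapeE newton omegaE t It.
  by rewrite derive1E.
- split; first exact: (derive1_height r m gam g e O phi t0 t1 A a).
  exact: (height_equation r m gam g e O phi lam t0 t1 A a).
Qed.
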